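(* Let $X$ be a non-zero real normed linear space and let $x \in X$ with $\|x\| = \frac12$. Then $(\frac12, x)$ has the order unit property in $\widetilde{X}$ if and only if $\widetilde{X}_{(\frac12, x)} = \mathbb{R}\,(\frac12, x)$.
   Context: $\widetilde{X} := \mathbb{R} \oplus_1 X$, i.e. $\mathbb{R}\times X$ with norm $\|(\alpha, x)\| = |\alpha| + \|x\|$, with the cone $\widetilde{X}^+ := \{(\alpha, x) \in \widetilde{X} : \|x\| \le \alpha\}$ and $e := (1,0)$. Then $(\widetilde{X}, e)$ is an order unit space (Archimedean ordered vector space with order unit $e$) whose order unit norm $\inf\{k>0 : ke \pm v \in \widetilde{X}^+\}$ is the given norm. For an order unit space $(V,e)$ with order unit norm $\|\cdot\|$, $u \in V^+$ has the order unit property (OUP) in $V$ if, for every $v \in V$, $\|v\| u \pm v \in V^+$ whenever $\lambda u \pm v \in V^+$ for some real $\lambda > 0$. For $u \in V^+$, $V_u := \{v \in V : \lambda u \pm v \in V^+ \text{ for some } \lambda > 0\}$; thus $\widetilde{X}_{(\frac12,x)}$ is $V_u$ for $V = \widetilde{X}$ and $u = (\frac12, x)$. $\mathbb{R}\,u$ denotes the linear span of $u$. *)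

(* Defs.v *)
From HB Require Import structures.
From mathcomp Require Import all_boot all_order all_algebra.
From mathcomp Require Import lra.
From mathcomp Require Import all_classical all_reals all_analysis.

Set Implicit Arguments.
Unset Strict Implicit.
Unset Printing Implicit Defensive.

Import Order.TTheory GRing.Theory Num.Theory.
Import numFieldNormedType.Exports.
Local Open Scope classical_set_scope.
Local Open Scope ring_scope.

Record orderUnitSpace (R : realType) (V : lmodType R) := OrderUnitSpace {
  ou_cone : set V;
  ou_unit : V;
  ou_coneD : forall v w, ou_cone v -> ou_cone w -> ou_cone (v + w);
  ou_coneZ : forall (k : R) v, 0 <= k -> ou_cone v -> ou_cone (k *: v);
  ou_cone_proper : forall v, ou_cone v -> ou_cone (- v) -> v = 0;
  ou_unit_cone : ou_cone ou_unit;
  ou_unitP : forall v, exists k : R,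
    [/\ 0 < k, ou_cone (k *: ou_unit + v) & ou_cone (k *: ou_unit - v)];
  ou_archimedean : forall u v, ou_cone u ->
    (forall k : R, 0 < k -> ou_cone (k *: u + v)) -> ou_cone v
}.

Section OrderUnitSpaceTheory.
Context (R : realType) (V : lmodType R) (S : orderUnitSpace V).

Definition ou_norm (v : V) : R :=
  inf [set k : R | [/\ 0 < k, ou_cone S (k *: ou_unit S + v)
                            & ou_cone S (k *: ou_unit S - v)]].

(* The set V_u. *)
Definition ou_local (u : V) : set V :=
  [set v | exists lam : R,
    [/\ 0 < lam, ou_cone S (lam *: u + v) & ou_cone S (lam *: u - v)]].

Definition order_unit_property (u : V) : Prop :=
  ou_cone S u /\
  forall v, ou_local u v ->
    ou_cone S (ou_norm v *: u + v) /\ ou_cone S (ou_norm v *: u - v).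

End OrderUnitSpaceTheory.

(* An alias of the product, whose own normed structure is the sup norm. *)
Definition l1sum (R : realType) (X : normedModType R) : Type := (R^o * X)%type.

Section L1Sum.
Context (R : realType) (X : normedModType R).

HB.instance Definition _ := GRing.Lmodule.copy (l1sum X) (R^o * X)%type.

Implicit Types v w : l1sum X.

Definition l1norm v : R := `|v.1| + `|v.2|.

Lemma l1normD v w : l1norm (v + w) <= l1norm v + l1norm w.
Proof.
rewrite /l1norm /= addrACA; apply: lerD; exact: ler_normD.
Qed.

Lemma l1normZ (k : R) v : l1norm (k *: v) = `|k| * l1norm v.
Proof. by rewrite /l1norm /= !normrZ mulrDr. Qed.

Lemma l1norm0_eq0 v : l1norm v = 0 -> v = 0.
Proof.
case: v => a y /eqP; rewrite /l1norm /= paddr_eq0 // !normr_eq0.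
by case/andP=> /eqP -> /eqP ->.
Qed.

HB.instance Definition _ :=
  Lmodule_isNormed.Build R (l1sum X) l1normD l1normZ l1norm0_eq0.

Lemma l1sum_normE v : `|v| = `|v.1| + `|v.2|.
Proof. by []. Qed.

Definition l1cone : set (l1sum X) := [set v | `|v.2| <= v.1].

Definition l1unit : l1sum X := (1, 0).

Lemma l1coneD v w : l1cone v -> l1cone w -> l1cone (v + w).
Proof.
move=> hv hw; rewrite /l1cone /=.
by apply: le_trans (ler_normD _ _) _; apply: lerD.
Qed.

Lemma l1coneZ (k : R) v : 0 <= k -> l1cone v -> l1cone (k *: v).
Proof. by move=> k0 hv; rewrite /l1cone /= normrZ ger0_norm // ler_wpM2l. Qed.

Lemma l1cone_proper v : l1cone v -> l1cone (- v) -> v = 0.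
Proof.
case: v => a y; rewrite /l1cone /= normrN => h1 h2.
have y0 := normr_ge0 y.
have /eqP : `|y| = 0 by lra.
rewrite normr_eq0 => /eqP yE; rewrite yE; congr (_, _).
by move: h1 h2; rewrite yE normr0 => h1 h2; lra.
Qed.

Lemma l1unit_cone : l1cone l1unit.
Proof. by rewrite /l1cone /= normr0. Qed.

Lemma l1cone_unitE (k : R) v :
  (l1cone (k *: l1unit + v) /\ l1cone (k *: l1unit - v)) <-> `|v| <= k.
Proof.
rewrite l1sum_normE /l1cone /= !scaler0 !add0r normrN /GRing.scale /= mulr1.
case: v => a y /=; split=> [[h1 h2]|h].
  by have [a0|a0] := lerP 0 a; [rewrite ger0_norm | rewrite ltr0_norm] => //; lra.
have ha : a <= `|a| by exact: ler_norm.
have hb : - a <= `|a| by rewrite -normrN; exact: ler_norm.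
by split; lra.
Qed.

Lemma l1unitP v : exists k : R,
  [/\ 0 < k, l1cone (k *: l1unit + v) & l1cone (k *: l1unit - v)].
Proof.
have v0 := normr_ge0 v.
have /l1cone_unitE [h1 h2] : `|v| <= `|v| + 1 by lra.
by exists (`|v| + 1); split=> //; lra.
Qed.

Lemma l1archimedean u v : l1cone u ->
  (forall k : R, 0 < k -> l1cone (k *: u + v)) -> l1cone v.
Proof.
case: u v => [b z] [a y]; rewrite /l1cone /= => hu h.
apply/ler_addgt0Pr => eps eps0.
have z0 := normr_ge0 z.
have c0 : 0 < b + `|z| + 1 by lra.
pose k := eps / (b + `|z| + 1).
have k0 : 0 < k by rewrite divr_gt0.
have hk : k * (b + `|z| + 1) = eps by rewrite divfK // gt_eqF.
have := h k k0; rewrite /GRing.scale /= => {}h.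
have : `|y| <= `|k *: z + y| + `|k *: z|.
  by rewrite -[X in `|X| <= _](addKr (k *: z)) addrC -(normrN (k *: z)) ler_normD.
by rewrite normrZ gtr0_norm // => h'; nra.
Qed.

Definition l1sum_ou : orderUnitSpace (l1sum X) :=
  OrderUnitSpace l1coneD l1coneZ l1cone_proper l1unit_cone l1unitP l1archimedean.

Lemma l1sum_ou_normE v : ou_norm l1sum_ou v = `|v|.
Proof.
rewrite /ou_norm /=; set A := (X in inf X).
have v0 := normr_ge0 v.
have inA k : 0 < k -> `|v| <= k -> A k.
  by move=> k0 /l1cone_unitE [h1 h2]; split.
have lbA : lbound A `|v| by move=> k [_ h1 h2]; apply/l1cone_unitE.
apply/eqP; rewrite eq_le; apply/andP; split.
  apply/ler_addgt0Pr => eps eps0.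
  by apply: ge_inf; [exists `|v| | apply: inA; lra].
by apply: lb_le_inf => //; exists (`|v| + 1); apply: inA; lra.
Qed.

End L1Sum.

Arguments l1sum_ou {R} X.

(* Main.v *)
Require Import Defs.
From mathcomp Require Import all_boot all_order all_algebra.
From mathcomp Require Import lra.
From mathcomp Require Import all_classical all_reals all_analysis.
Import Order.TTheory GRing.Theory Num.Theory.
Import numFieldNormedType.Exports.
Local Open Scope classical_set_scope.
Local Open Scope ring_scope.

(** Write u = (1/2, x), a norm-one element on the boundary of the cone.

    If V_u is the line spanned by u, the order unit property only has to be
    tested on v = a u, where it says that |a| + a and |a| - a are nonnegative.

    Conversely, V_u is stable under translation by multiples of u, because u is
    positive ([ou_local_addZ]). Hence every v in V_u may be moved along u until
    its scalar coordinate vanishes, that is, to some w = (0, y) in V_u. For such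
    a w the order unit property gives |n x + y| <= n / 2 and
    |n x - y| <= n / 2, with n = |w| = |y|. As 2 y is the difference of the two
    vectors on the left, 2 n <= n, so y = 0 ([oup_fst0]): v was already
    a multiple of u. *)

Section Local.
Context (R : realType) (V : lmodType R) (S : orderUnitSpace V).
Implicit Types (u v : V) (a : R).

Lemma ou_cone_normDl u a : ou_cone S u ->
  ou_cone S (`|a| *: u + a *: u) /\ ou_cone S (`|a| *: u - a *: u).
Proof.
move=> hu; rewrite -scalerDl -scalerBl.
split; apply: ou_coneZ => //.
  by rewrite -lerBlDr sub0r -normrN ler_norm.
by rewrite subr_ge0 ler_norm.
Qed.

(** If lam works for v, then lam + |a| works for v + a u: the extra term
    |a| u + a u, or |a| u - a u, is positive. *)
Lemma ou_local_addZ u v a : ou_cone S u ->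
  ou_local S u v -> ou_local S u (v + a *: u).
Proof.
move=> hu [lam [lam0 hp hm]]; have [ap am] := ou_cone_normDl _ a hu.
exists (lam + `|a|); split; first exact: ltr_wpDr.
- by rewrite scalerDl addrACA; exact: ou_coneD.
- by rewrite scalerDl opprD addrACA; exact: ou_coneD.
Qed.

Lemma ou_localZ u a : ou_cone S u -> ou_local S u (a *: u).
Proof.
move=> hu; rewrite -[a *: u]add0r; apply: ou_local_addZ => //.
by exists 1; rewrite subr0 addr0 scale1r; split.
Qed.

End Local.

(** The norm of (0, y) is |y|, so the property puts both | |y| x + y | and
    | |y| x - y | below |y| b. By the triangle inequality 2 |y| <= 2 |y| b,
    which forces y = 0 as soon as b < 1. *)
Lemma oup_fst0 (R : realType) (X : normedModType R) (b : R) (x y : X) :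
  b < 1 -> order_unit_property (l1sum_ou X) (b, x) ->
  ou_local (l1sum_ou X) (b, x) (0, y) -> y = 0.
Proof.
move=> b1 [_ oup] /oup; rewrite l1sum_ou_normE l1sum_normE /= normr0 add0r.
rewrite /l1cone /= /GRing.scale /= subr0 addr0 => -[hp hm].
have h2 : `|y *+ 2| <= `| `|y| *: x + y| + `| `|y| *: x - y|.
  apply: le_trans (ler_normB _ _); rewrite opprB addrC addrA subrK.
  by rewrite mulr2n.
move: h2; rewrite normrMn mulr2n => h2.
have y0 := normr_ge0 y.
by apply/eqP; rewrite -normr_eq0; apply/eqP; nra.
Qed.

Theorem proposition5p2 (R : realType) (X : normedModType R)
    (hX : exists y : X, y != 0) (x : X) (hx : `|x| = 2^-1) :
  let u : l1sum X := (2^-1, x) in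
  order_unit_property (l1sum_ou X) u <->
  ou_local (l1sum_ou X) u = [set a *: u | a in [set: R]].
Proof.
move=> u.
have hu : ou_cone (l1sum_ou X) u by rewrite /= /l1cone /= hx.
have half_lt1 : 2^-1 < 1 :> R by lra.
split=> [oup|luE].
  apply/seteqP; split=> [[a y] hv|_ [a _ <-]]; last exact: ou_localZ.
  (* The scalar coordinate of u is 1/2, so subtracting 2 a u kills a. *)
  have := ou_local_addZ _ _ _ _ _ (- (2 * a)) hu hv.
  have -> : ((a, y) : l1sum X) + (- (2 * a)) *: u = (0, y + (- (2 * a)) *: x).
    by congr (_, _); rewrite /= /GRing.scale /=; lra.
  move/(oup_fst0 _ _ _ _ _ half_lt1 oup) => y0.
  exists (2 * a) => //; congr (_, _); first by rewrite /= /GRing.scale /=; lra.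
  by apply/esym/eqP; rewrite -subr_eq0 -scaleNr y0.
split=> // v; rewrite luE => -[a _ <-].
have u1 : `|u| = 1 by rewrite l1sum_normE /= hx ger0_norm ?invr_ge0 //; lra.
rewrite l1sum_ou_normE normrZ u1 mulr1; exact: ou_cone_normDl.
Qed.
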